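(* Let $\Omega>0$, $\Delta t_{\mathrm{block}}>0$ and $\bar\ell>0$, and consider the total expected cost $$C(f)=\frac{2\Omega^2}{f}+f\,\Delta t_{\mathrm{block}}\,\bar\ell,\qquad f>0\ (f\in\mathbb R).$$ Setting $dC/df=0$ yields the optimal step count $$f^*=\Omega\sqrt{\frac{2}{\Delta t_{\mathrm{block}}\,\bar\ell}}.$$ At this optimum the rebalancing cost $2\Omega^2/f^*$ and the LVR cost $f^*\Delta t_{\mathrm{block}}\bar\ell$ are equal, and the minimum total cost is $$C(f^* )=2\sqrt{2\,\Omega^2\,\Delta t_{\mathrm{block}}\,\bar\ell},$$ which scales as $\Omega\sigma$ (where $\sigma$ is a common scale of the asset volatilities, $\bar\ell$ being proportional to $\sigma^2$).
   Context: $\Omega=\arccos\left(\sum_i\sqrt{w_i^{\mathrm{start}}w_i^{\mathrm{end}}}\right)$ is the geodesic angle between start and end weights, $\Delta t_{\mathrm{block}}$ the block time, and $\bar\ell=\int_0^1\ell(\mathbf w_{\mathrm{SLERP}}(s))\,ds$ the average along the SLERP curve from $\mathbf w^{\mathrm{start}}$ to $\mathbf w^{\mathrm{end}}$ of the LVR (loss-versus-rebalancing) rate $\ell(\mathbf w)=\frac12\left[\sum_iw_i\sigma_i^2-\mathbf w^T\Sigma\mathbf w\right]$, $\Sigma_{ij}=\sigma_i\sigma_j\rho_{ij}$ (with $\sigma_i$ the volatility of asset $i$ and $\rho_{ij}$ the correlations); $\bar\ell$ does not depend on $f$. The SLERP curve is $w_i(s)=\left[\frac{\sin((1-s)\Omega)}{\sin\Omega}\sqrt{w_i^{\mathrm{start}}}+\frac{\sin(s\Omega)}{\sin\Omega}\sqrt{w_i^{\mathrm{end}}}\right]^2$.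 *)

(* Defs.v *)
From mathcomp Require Import all_boot all_order all_algebra.
From mathcomp Require Import all_classical all_reals all_analysis.

Set Implicit Arguments.
Unset Strict Implicit.
Unset Printing Implicit Defensive.

Import Order.TTheory GRing.Theory Num.Theory.
Import numFieldNormedType.Exports.

Local Open Scope ring_scope.
Local Open Scope classical_set_scope.

Definition is_weights (R : realType) (n : nat) (w : 'cV[R]_n) : Prop :=
  (forall i, 0 <= w i 0) /\ \sum_i w i 0 = 1.

Definition is_correlation (R : realType) (n : nat) (rho : 'M[R]_n) : Prop :=
  [/\ rho^T = rho,
      forall i, rho i i = 1
    & forall x : 'cV[R]_n, 0 <= (x^T *m rho *m x) 0 0].

Definition covariance_mx (R : realType) (n : nat)
    (sigma : 'cV[R]_n) (rho : 'M[R]_n) : 'M[R]_n :=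
  \matrix_(i, j) (sigma i 0 * sigma j 0 * rho i j).

Definition lvr_rate (R : realType) (n : nat)
    (sigma : 'cV[R]_n) (rho : 'M[R]_n) (w : 'cV[R]_n) : R :=
  2^-1 * (\sum_i w i 0 * sigma i 0 ^+ 2
          - (w^T *m covariance_mx sigma rho *m w) 0 0).

Definition geodesic_angle (R : realType) (n : nat) (w0 w1 : 'cV[R]_n) : R :=
  acos (\sum_i Num.sqrt (w0 i 0 * w1 i 0)).

(* Meaningful for [sin (geodesic_angle w0 w1) != 0], that is (for weight
   vectors) [w0 != w1]; division by zero returns zero otherwise. *)
Definition slerp (R : realType) (n : nat) (w0 w1 : 'cV[R]_n) (s : R)
    : 'cV[R]_n :=
  let Omega := geodesic_angle w0 w1 in
  \col_i (sin ((1 - s) * Omega) / sin Omega * Num.sqrt (w0 i 0)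
          + sin (s * Omega) / sin Omega * Num.sqrt (w1 i 0)) ^+ 2.

Definition mean_lvr_rate (R : realType) (n : nat)
    (w0 w1 sigma : 'cV[R]_n) (rho : 'M[R]_n) : R :=
  \int[lebesgue_measure]_(s in `[0, 1]) lvr_rate sigma rho (slerp w0 w1 s).

Definition rebalancing_cost (R : realType) (Omega f : R) : R :=
  2 * Omega ^+ 2 / f.

Definition lvr_cost (R : realType) (dt lbar f : R) : R := f * dt * lbar.

Definition total_cost (R : realType) (Omega dt lbar f : R) : R :=
  rebalancing_cost Omega f + lvr_cost dt lbar f.

Definition optimal_steps (R : realType) (Omega dt lbar : R) : R :=
  Omega * Num.sqrt (2 / (dt * lbar)).

(* Main.v *)
(** Writing [g] for the optimal step count, [dt * lbar * g ^+ 2 = 2 * Omega ^+ 2],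
    so completing the square gives [C f - C g = dt * lbar * (f - g) ^+ 2 / f].
    The [sigma]-scaling is the quadratic homogeneity of the LVR rate in the
    volatilities, which passes through the integral because the rate is
    continuous along the SLERP curve. *)

Require Import Defs.
From mathcomp Require Import all_boot all_order all_algebra.
From mathcomp Require Import all_classical all_reals all_analysis.
From mathcomp Require Import ring.

Set Implicit Arguments.
Unset Strict Implicit.
Unset Printing Implicit Defensive.

Import Order.TTheory GRing.Theory Num.Theory.
Import numFieldNormedType.Exports.

Local Open Scope ring_scope.
Local Open Scope classical_set_scope.

(** With matrix products expanded into coordinates, both the scaling law and the continuity can be
    checked term by term. *)
Lemma lvr_rateE (R : realType) (n : nat) (sigma : 'cV[R]_n) (rho : 'M[R]_n)
    (w : 'cV[R]_n) :
  lvr_rate sigma rho w =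
  2^-1 * (\sum_i w i 0 * sigma i 0 ^+ 2
          - \sum_j \sum_i w i 0 * (sigma i 0 * sigma j 0 * rho i j) * w j 0).
Proof.
rewrite /lvr_rate mxE; congr (2^-1 * (_ - _)); apply: eq_bigr => j _.
by rewrite mxE big_distrl; apply: eq_bigr => i _; rewrite !mxE.
Qed.

Lemma lvr_rateZ (R : realType) (n : nat) (c : R) (sigma : 'cV[R]_n)
    (rho : 'M[R]_n) (w : 'cV[R]_n) :
  lvr_rate (c *: sigma) rho w = c ^+ 2 * lvr_rate sigma rho w.
Proof.
rewrite !lvr_rateE [RHS]mulrCA; congr (2^-1 * _).
rewrite mulrBr; congr (_ - _); rewrite big_distrr /=.
  by apply: eq_bigr => i _; rewrite mxE; ring.
apply: eq_bigr => j _; rewrite big_distrr /=; apply: eq_bigr => i _.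
by rewrite !mxE; ring.
Qed.

Lemma continuous_mul (R : realType) (f g : R -> R) :
  continuous f -> continuous g -> continuous (fun x => f x * g x).
Proof. by move=> cf cg x; apply: (@continuousM _ _ f g); [exact: cf | exact: cg]. Qed.

Lemma continuous_sum (R : realType) (I : finType) (f : I -> R -> R) :
  (forall i, continuous (f i)) -> continuous (fun x => \sum_i f i x).
Proof.
by move=> cf; apply: continuous_big => [|i _]; [exact: add_continuous | exact: cf].
Qed.

(** The divisor [sin Om] does not depend on [s], so each coordinate is the square of a combination
    of sines with constant coefficients. If [sin Om] is 0, division yields 0 and the curve is
    constantly 0. *)
Lemma slerp_continuous (R : realType) (n : nat) (w0 w1 : 'cV[R]_n) (i : 'I_n) :
  continuous (fun s => slerp w0 w1 s i 0).
Proof.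
set Om := geodesic_angle w0 w1.
have cst (c : R) : continuous (fun _ : R => c) by exact: cst_continuous.
have sin_continuous (f : R -> R) (a c : R) : continuous f ->
    continuous (fun t => sin (f t * Om) / a * c).
  move=> cf; apply: (continuous_mul (f := fun t => sin (f t * Om) / a)) => //.
  apply: (continuous_mul (f := fun t => sin (f t * Om))) => //.
  move=> t; apply: (@continuous_comp _ _ _ (fun t => f t * Om) sin).
    exact: (continuous_mul (f := f)).
  exact: continuous_sin.
rewrite (_ : (fun _ => _) = (fun x : R => x ^+ 2) \o (fun t : R =>
  sin ((1 - t) * Om) / sin Om * Num.sqrt (w0 i 0)
  + sin (t * Om) / sin Om * Num.sqrt (w1 i 0))); last first.
  by apply/funext => t; rewrite mxE.
move=> s; apply: continuous_comp; last exact: exprn_continuous.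
apply: continuousD.
  apply: (sin_continuous (fun t => 1 - t)) => t.
  by apply: continuousB; [exact: cst | exact: cvg_id].
by apply: (sin_continuous id) => t; exact: cvg_id.
Qed.

Lemma lvr_rate_slerp_continuous (R : realType) (n : nat)
    (w0 w1 sigma : 'cV[R]_n) (rho : 'M[R]_n) :
  continuous (fun s => lvr_rate sigma rho (slerp w0 w1 s)).
Proof.
have cst (c : R) : continuous (fun _ : R => c) by exact: cst_continuous.
pose w s i := slerp w0 w1 s i 0.
have cw i : continuous (w^~ i) by exact: slerp_continuous.
under eq_fun do rewrite lvr_rateE.
apply: (continuous_mul (f := fun=> 2^-1)) => // s; apply: continuousB.
  apply: (continuous_sum (f := fun i s => w s i * sigma i 0 ^+ 2)) => i.
  exact: (continuous_mul (f := w^~ i)).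
pose c i j := sigma i 0 * sigma j 0 * rho i j.
apply: (continuous_sum (f := fun j s => \sum_i w s i * c i j * w s j)) => j.
apply: (continuous_sum (f := fun i s => w s i * c i j * w s j)) => i.
apply: (continuous_mul (f := fun s => w s i * c i j)) => //.
exact: (continuous_mul (f := w^~ i)).
Qed.

Lemma mean_lvr_rateZ (R : realType) (n : nat) (c : R)
    (w0 w1 sigma : 'cV[R]_n) (rho : 'M[R]_n) :
  mean_lvr_rate w0 w1 (c *: sigma) rho = c ^+ 2 * mean_lvr_rate w0 w1 sigma rho.
Proof.
rewrite /mean_lvr_rate; under eq_Rintegral do rewrite lvr_rateZ.
rewrite RintegralZl //.
(* Pulling the constant out requires integrability, which follows from continuity on the compact
   segment. *)
apply: continuous_compact_integrable; first exact: segment_compact.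
exact/continuous_subspaceT/lvr_rate_slerp_continuous.
Qed.

Lemma optimal_steps_gt0 (R : realType) (Omega dt lbar : R) :
  0 < Omega -> 0 < dt -> 0 < lbar -> 0 < optimal_steps Omega dt lbar.
Proof. by move=> *; rewrite mulr_gt0 // sqrtr_gt0 divr_gt0 // mulr_gt0. Qed.

Lemma optimal_steps_sqr (R : realType) (Omega dt lbar : R) :
  0 < dt -> 0 < lbar ->
  dt * lbar * optimal_steps Omega dt lbar ^+ 2 = 2 * Omega ^+ 2.
Proof.
move=> dt0 l0; rewrite exprMn sqr_sqrtr; last first.
  by rewrite divr_ge0 // mulr_ge0 // ltW.
by field; rewrite !gt_eqF.
Qed.

Lemma total_costB (R : realType) (Omega dt lbar f : R) :
  0 < Omega -> 0 < dt -> 0 < lbar -> 0 < f ->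
  total_cost Omega dt lbar f
    - total_cost Omega dt lbar (optimal_steps Omega dt lbar) =
  dt * lbar * (f - optimal_steps Omega dt lbar) ^+ 2 / f.
Proof.
move=> O0 dt0 l0 f0; have := optimal_steps_gt0 O0 dt0 l0.
(* Trading [2 * Omega ^+ 2] for [dt * lbar * g ^+ 2] removes the square root: what remains is an
   identity of rational functions in [f] and [g]. *)
rewrite /total_cost /rebalancing_cost /lvr_cost -(optimal_steps_sqr Omega dt0 l0).
set g := optimal_steps _ _ _ => g0.
by field; rewrite !gt_eqF.
Qed.

Lemma is_derive_total_cost (R : realType) (Omega dt lbar f : R) : f != 0 ->
  is_derive f 1 (total_cost Omega dt lbar)
    (dt * lbar - 2 * Omega ^+ 2 / f ^+ 2).
Proof.
move=> f0.
have fV : is_derive f 1 (fun x : R => x^-1) (- f ^- 2 *: 1).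
  exact: is_deriveV.
(* As a linear combination of the inverse and the identity, the cost is differentiated by the
   inferred [is_derive] instances, with [fV] supplying the inverse. *)
rewrite (_ : total_cost _ _ _ =
  (2 * Omega ^+ 2) *: (fun x : R => x^-1) + (dt * lbar) *: (id : R -> R));
  last first.
  apply/funext => x; rewrite /total_cost /rebalancing_cost /lvr_cost.
  by rewrite -[RHS]/(2 * Omega ^+ 2 * x^-1 + dt * lbar * x); ring.
apply: is_derive_eq.
by rewrite /GRing.scale /=; ring.
Qed.

Theorem proposition6 (R : realType) (Omega dt lbar : R)
    (Omega_gt0 : 0 < Omega) (dt_gt0 : 0 < dt) (lbar_gt0 : 0 < lbar) :
  let C := total_cost Omega dt lbar in
  let fstar := optimal_steps Omega dt lbar in
  [/\ 0 < fstar
      /\ (forall f : R, 0 < f ->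
            derivable C f 1 /\ (C^`() f = 0 <-> f = fstar)),
      forall f : R, 0 < f -> f != fstar -> C fstar < C f,
      rebalancing_cost Omega fstar = lvr_cost dt lbar fstar,
      C fstar = 2 * Num.sqrt (2 * Omega ^+ 2 * dt * lbar)
    & forall (n : nat) (wstart wend v : 'cV[R]_n) (rho : 'M[R]_n) (sigma : R),
        is_weights wstart -> is_weights wend ->
        (forall i, 0 <= v i 0) -> is_correlation rho -> 0 < sigma ->
        Omega = geodesic_angle wstart wend ->
        lbar = mean_lvr_rate wstart wend (sigma *: v) rho ->
        lbar = sigma ^+ 2 * mean_lvr_rate wstart wend v rho
        /\ C fstar = 2 * Num.sqrt (2 * dt * mean_lvr_rate wstart wend v rho)
                     * (Omega * sigma)].
Proof.
move=> C fstar.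
have fstar_gt0 : 0 < fstar by exact: optimal_steps_gt0.
have fstar_sqr : dt * lbar * fstar ^+ 2 = 2 * Omega ^+ 2.
  exact: optimal_steps_sqr.
have cost_eq : rebalancing_cost Omega fstar = lvr_cost dt lbar fstar.
  by rewrite /rebalancing_cost /lvr_cost -fstar_sqr; field; rewrite gt_eqF.
have Cfstar : C fstar = 2 * Num.sqrt (2 * Omega ^+ 2 * dt * lbar).
  rewrite /C /total_cost cost_eq /lvr_cost -fstar_sqr.
  (* The two costs being equal, the total is twice the LVR cost, and the radicand is exactly the
     square of that cost. *)
  rewrite (_ : _ * _ * dt * lbar = (fstar * dt * lbar) ^+ 2); last by ring.
  rewrite sqrtr_sqr ger0_norm; first by ring.
  by rewrite !mulr_ge0 // ltW.
split => //.
- split => // f f0.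
  have dC := is_derive_total_cost Omega dt lbar (lt0r_neq0 f0).
  split; first exact: ex_derive.
  rewrite derive1E derive_val -fstar_sqr.
  (* The derivative is a positive multiple of [f ^+ 2 - fstar ^+ 2], and squaring is injective on
     nonnegative numbers, so [fstar] is the only positive zero. *)
  have -> : dt * lbar - dt * lbar * fstar ^+ 2 / f ^+ 2
      = dt * lbar / f ^+ 2 * (f ^+ 2 - fstar ^+ 2).
    by field; rewrite gt_eqF.
  split=> [/eqP|->]; last by rewrite subrr mulr0.
  rewrite mulf_eq0 gt_eqF ?divr_gt0 ?mulr_gt0 ?exprn_gt0 //= subr_eq0.
  by rewrite eqrXn2 ?ltW // => /eqP.
- move=> f f0 ff; rewrite -subr_gt0 total_costB //.
  apply: divr_gt0 => //; apply: mulr_gt0; first exact: mulr_gt0.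
  by rewrite exprn_even_gt0 //= subr_eq0.
- move=> n w0 w1 v rho sigma _ _ _ _ sigma_gt0 _ lbarE.
  have lbarZ : lbar = sigma ^+ 2 * mean_lvr_rate w0 w1 v rho.
    by rewrite {1}lbarE mean_lvr_rateZ.
  split => //; rewrite Cfstar {1}lbarZ; set m := mean_lvr_rate _ _ _ _.
  (* The volatility scale enters [lbar] squared, so it joins [Omega] in a perfect square that leaves
     the root as the positive factor [Omega * sigma]. *)
  rewrite (_ : 2 * _ * _ * _ = (Omega * sigma) ^+ 2 * (2 * dt * m)); last by ring.
  rewrite sqrtrM ?sqr_ge0 // sqrtr_sqr ger0_norm; first by ring.
  by rewrite mulr_ge0 // ltW.
Qed.
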